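(* Let $p\ge 3$ be a prime, and for $x\in\mathbb{N}$ let $$S_p(x)=\sum_{0\le n<x,\ n\equiv 0 \ (\mathrm{mod}\ p)}(-1)^{\sigma(n)},$$ where $\sigma(n)$ denotes the number of $1$'s in the binary expansion of $n$. Suppose that $$|S_p(n)|\le n^{\frac{\ln p}{(p-1)\ln 2}}\quad\text{for all integers } n\ge 2^p,$$ and that $p$ divides $S_p(2^p)$. Then $S_p(2^p)=\pm p$.
   Context: For $m,x\in\mathbb{N}$, $S_m(x)=\sum_{0\le n<x,\ m\mid n}(-1)^{\sigma(n)}$, where $\sigma(n)$ is the binary digit sum (number of ones in the binary expansion) of $n$. *)

(* Defs.v *)
From mathcomp Require Import all_boot all_order all_algebra.

Set Implicit Arguments.
Unset Strict Implicit.
Unset Printing Implicit Defensive.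

Import GRing.Theory.

(* The number of 1's in the binary expansion of n.  The i-th binary digit of n
   is odd (n %/ 2 ^ i); it vanishes for i >= n because n < 2 ^ n. *)
Definition bin_digit_sum (n : nat) : nat := \sum_(i < n) odd (n %/ 2 ^ i).

Definition signed_sum (m x : nat) : int :=
  (\sum_(0 <= n < x | (m %| n)%N) (-1) ^+ bin_digit_sum n)%R.

(* Main.v *)
Require Import Defs.
From mathcomp Require Import all_boot all_order all_algebra all_field cyclic.
From mathcomp Require Import ring zify.
From mathcomp Require Import all_classical all_reals all_analysis.

(* Let z be a primitive p-th root of unity and, for 0 < j < p, let A_j be the
   product of the 1 - z^(j 2^k) over k < p - 1.  Discrete Fourier inversion of
   the product formula for \sum_n (-1)^(sigma n) x^n gives, since
   2^(p-1) = 1 mod p, that p S_p(2^((p-1) m)) is the sum of the A_j^m.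
   Conjugation shows that A_j is real, so for even m the sum has nonnegative
   terms, and the growth hypothesis along n = 2^((p-1) m) forces |A_j| <= p.
   But the A_j have product p^(p-1), hence each is p or -p; being Galois
   conjugate rationals they are all equal to the same e p, and
   p S_p(2^p) = \sum_j A_j (1 - z^j) = e p^2. *)

Set Implicit Arguments.
Unset Strict Implicit.
Unset Printing Implicit Defensive.

Import Order.TTheory GRing.Theory Num.Theory.

Local Open Scope ring_scope.

(** * Binary digits and the Thue-Morse product *)

Lemma bin_digit_sum_widen m n : (n < 2 ^ m)%N ->
  bin_digit_sum n = (\sum_(i < m) odd (n %/ 2 ^ i))%N.
Proof.
have digits_vanish a b : (n < 2 ^ a)%N -> (a <= b)%N ->
    (\sum_(0 <= i < b) odd (n %/ 2 ^ i) = \sum_(0 <= i < a) odd (n %/ 2 ^ i))%N.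
  move=> n_lt le_ab; rewrite (big_cat_nat (n := a)) //=.
  rewrite [X in (_ + X)%N]big_nat_cond [X in (_ + X)%N]big1 ?addn0 // => i /andP[/andP[ai _] _].
  by rewrite divn_small // (leq_trans n_lt) // leq_exp2l.
move=> n_lt; rewrite /bin_digit_sum.
rewrite -!(big_mkord xpredT (fun i => nat_of_bool (odd (n %/ 2 ^ i)))).
by have [/digits_vanish->|/ltnW/digits_vanish->] := leqP n m; rewrite // ltn_expl.
Qed.

Lemma bin_digit_sum_add_pow2 m n : (n < 2 ^ m)%N ->
  bin_digit_sum (2 ^ m + n) = (bin_digit_sum n).+1.
Proof.
move=> n_lt; rewrite (@bin_digit_sum_widen m.+1); last first.
  by rewrite expnS mul2n -addnn ltn_add2l.
rewrite big_ord_recr /= (bin_digit_sum_widen n_lt).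
rewrite divnDl // divnn expn_gt0 /= divn_small // addn0 addn1; congr _.+1.
(* For [i < m] the quotient [2 ^ m %/ 2 ^ i] is even, so the lower digits are those of [n]. *)
apply: eq_bigr => i _; rewrite divnDl ?dvdn_exp2l 1?ltnW //.
rewrite -{1}(subnK (ltnW (ltn_ord i))) expnD mulnK ?expn_gt0 //.
by rewrite oddD oddX /= subn_eq0 leqNgt ltn_ord.
Qed.

Definition dyadic_prod (R : comNzRingType) m (x : R) : R :=
  \prod_(k < m) (1 - x ^+ (2 ^ k)).

Lemma dyadic_prodS (R : comNzRingType) m (x : R) :
  dyadic_prod m.+1 x = dyadic_prod m x * (1 - x ^+ (2 ^ m)).
Proof. exact: big_ord_recr. Qed.

(** Adding [2 ^ m] to an index below [2 ^ m] flips its sign and shifts its power, so the upper half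
    of the sum is [- x ^+ (2 ^ m)] times the lower half. *)
Lemma sum_thue_morse (R : comNzRingType) (x : R) m :
  \sum_(0 <= n < 2 ^ m) (-1) ^+ bin_digit_sum n * x ^+ n = dyadic_prod m x.
Proof.
elim: m => [|m IHm].
  by rewrite /dyadic_prod big_ord0 big_nat1 /bin_digit_sum big_ord0 !expr0 mulr1.
rewrite dyadic_prodS -IHm (big_cat_nat (n := (2 ^ m)%N)) //=; last first.
  by rewrite leq_exp2l.
rewrite mulrBr mulr1 -[in RHS]mulrN; congr (_ + _).
rewrite -{1}[(2 ^ m)%N]add0n big_addn expnS mul2n -addnn addnK mulr_suml.
apply: eq_big_nat => n /andP[_ n_lt].
by rewrite addnC bin_digit_sum_add_pow2 // exprS exprD; ring.
Qed.

(** * Fourier inversion over roots of unity *)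

Lemma sum_expr_prim_root (F : fieldType) n (z : F) i : n.-primitive_root z ->
  \sum_(j < n) (z ^+ j) ^+ i = if (n %| i)%N then n%:R else 0.
Proof.
move=> prim_z; have -> : \sum_(j < n) (z ^+ j) ^+ i = \sum_(j < n) (z ^+ i) ^+ j.
  by apply: eq_bigr => j _; rewrite exprAC.
rewrite (prim_order_dvd prim_z); case: eqVneq => [->|zi_neq1].
  by under eq_bigr do rewrite expr1n; rewrite sumr_const card_ord.
apply: (mulfI (_ : z ^+ i - 1 != 0)); first by rewrite subr_eq0.
by rewrite -subrX1 mulr0 exprAC (prim_expr_order prim_z) expr1n subrr.
Qed.

Lemma prod_sub1_prim_root (F : fieldType) n (z : F) : n.-primitive_root z ->
  \prod_(1 <= j < n) (1 - z ^+ j) = n%:R.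
Proof.
move=> prim_z; have n_gt0 := prim_order_gt0 prim_z.
have := factor_Xn_sub_1 prim_z; rewrite big_ltn // expr0 subrX1.
(* Cancel ['X - 1] from both factorizations of ['X^n - 1], then evaluate at 1. *)
move/(mulfI (negbT (polyXsubC_eq0 1)))/(congr1 (horner^~ 1)).
rewrite horner_prod horner_sum => eq_prod.
rewrite (eq_bigr (fun j => ('X - (z ^+ j)%:P).[1])) => [|j _].
  rewrite eq_prod; under eq_bigr do rewrite hornerXn expr1n.
  by rewrite sumr_const card_ord.
by rewrite hornerXsubC.
Qed.

Lemma signed_sum_prim_root (F : fieldType) p (z : F) m :
  p.-primitive_root z -> (0 < m)%N ->
  p%:R * (signed_sum p (2 ^ m))%:~R =
  \sum_(1 <= j < p) dyadic_prod m (z ^+ j).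
Proof.
move=> prim_z m_gt0; have p_gt0 := prim_order_gt0 prim_z.
(* The index [j = 0] drops out: as [0 < m], its product contains the factor [1 - 1] at [k = 0]. *)
have prod0 : dyadic_prod m (z ^+ 0) = 0.
  by rewrite /dyadic_prod (bigD1 (Ordinal m_gt0)) //= expr0 expr1n subrr mul0r.
transitivity (\sum_(0 <= j < p) dyadic_prod m (z ^+ j)); last first.
  by rewrite big_ltn // prod0 add0r.
rewrite big_mkord; under eq_bigr do rewrite -sum_thue_morse.
rewrite exchange_big /= /signed_sum rmorph_sum mulr_sumr big_mkcond /=.
apply: eq_bigr => n _; rewrite -mulr_sumr (sum_expr_prim_root _ prim_z).
by case: ifP; rewrite ?mulr0 // rmorphXn rmorphN1 mulrC.
Qed.

(** * Comparison of growth rates *)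

Lemma bernoulli_ineq (R : numDomainType) (d : R) n :
  0 <= d -> 1 + d *+ n <= (1 + d) ^+ n.
Proof.
move=> d_ge0; elim: n => [|n IHn]; first by rewrite mulr0n addr0 expr0.
rewrite exprS (le_trans _ (ler_wpM2l (addr_ge0 ler01 d_ge0) IHn)) //.
rewrite mulrDl mul1r mulrDr mulr1 mulrS addrA addrAC addrA.
by rewrite lerDl mulr_ge0 ?mulrn_wge0.
Qed.

(** If [b < a], the powers of [a / b] would outgrow the constant [c]. Only even powers are assumed,
    since those are the ones for which the sum of the A_j^m has nonnegative terms. *)
Lemma le_of_expr_le (R : archiNumFieldType) (a b c : R) :
  0 <= a -> 0 < b -> (forall n : nat, a ^+ n.+1 ^+ 2 <= c * b ^+ n.+1 ^+ 2) ->
  a <= b.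
Proof.
move=> a_ge0 b_gt0 le_ab.
rewrite real_leNgt ?(ger0_real a_ge0) ?(gtr0_real b_gt0) //; apply/negP => lt_ba.
pose d := a / b - 1.
have d_gt0 : 0 < d by rewrite subr_gt0 ltr_pdivlMr // mul1r.
have le_c n : 1 + d *+ n <= c.
  apply: (@le_trans _ _ ((1 + d) ^+ n.+1 ^+ 2)); last first.
    rewrite subrKC expr_div_n expr_div_n ler_pdivrMr ?exprn_gt0 //; exact: le_ab.
  rewrite (le_trans (bernoulli_ineq n (ltW d_gt0))) //.
  by rewrite -exprM ler_weXn2l ?lerDl ?ltW // muln2 -addnn; lia.
have c_ge0 : 0 <= c by rewrite (le_trans _ (le_c 0%N)) // mulr0n addr0.
have := archi_boundP (divr_ge0 c_ge0 (ltW d_gt0)).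
set n := Num.bound _; rewrite ltr_pdivrMr // mulr_natl => lt_c.
suff: c < c by rewrite ltxx.
by apply: lt_le_trans lt_c (le_trans _ (le_c n)); rewrite lerDr.
Qed.

(** * Periodicity and reality of dyadic products *)

Lemma expr_pow2M (R : comNzRingType) (x : R) q m :
  x ^+ (2 ^ q) = x -> x ^+ (2 ^ (q * m)) = x.
Proof.
move=> xq; elim: m => [|m IHm]; first by rewrite muln0 expr1.
by rewrite mulnS expnD exprM xq.
Qed.

Lemma dyadic_prod_period (R : comNzRingType) (x : R) q m :
  x ^+ (2 ^ q) = x -> dyadic_prod (q * m) x = dyadic_prod q x ^+ m.
Proof.
move=> xq; elim: m => [|m IHm]; first by rewrite muln0 /dyadic_prod big_ord0.
rewrite mulnS addnC /dyadic_prod big_split_ord /= -/(dyadic_prod _ _) IHm exprSr.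
congr (_ * _); apply: eq_bigr => k _.
by rewrite expnD exprM expr_pow2M.
Qed.

(** The exponents add up as 1 + (1 + 2 + ... + 2^(q-1)) = 2^q. *)
Lemma prod_expr_pow2 (R : comNzRingType) (x : R) q :
  x * \prod_(k < q) x ^+ (2 ^ k) = x ^+ (2 ^ q).
Proof.
elim: q => [|q IHq]; first by rewrite big_ord0 mulr1 expr1.
by rewrite big_ord_recr mulrA IHq -exprD addnn -mul2n expnS.
Qed.

(** Conjugation inverts [x], and 1 - 1/y = (1 - y)(-1/y). Over all y = x^(2^k) the extra factors
    -1/y multiply to 1: their signs cancel as [q] is even, and the y themselves have product 1 by
    [prod_expr_pow2]. *)
Lemma dyadic_prod_real (x : algC) q :
  `|x| = 1 -> ~~ odd q -> x ^+ (2 ^ q) = x -> dyadic_prod q x \is Num.real.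
Proof.
move=> x1 even_q xq; have x_neq0 : x != 0 by rewrite -normr_eq0 x1 oner_eq0.
rewrite CrealE rmorph_prod; apply/eqP.
have -> : dyadic_prod q x = dyadic_prod q x * \prod_(k < q) - (x ^+ (2 ^ k))^-1.
  rewrite prodrN card_ord -signr_odd (negbTE even_q) mul1r prodfV.
  have /(mulfI x_neq0)-> : x * \prod_(k < q) x ^+ (2 ^ k) = x * 1.
    by rewrite prod_expr_pow2 mulr1.
  by rewrite invr1 mulr1.
rewrite -big_split; apply: eq_bigr => k _ /=.
have xk_neq0 : x ^+ (2 ^ k) != 0 by rewrite expf_neq0.
rewrite rmorphB rmorph1 rmorphXn /= (_ : x^* = x^-1); last first.
  by rewrite invC_norm x1 expr1n invr1 mul1r.
by rewrite exprVn mulrN mulrBl mul1r divff // opprB.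
Qed.

(** * The growth hypothesis along powers of two *)

Lemma powR_rate (R : realType) p m : (1 < p)%N ->
  ((2 ^ (p.-1 * m))%:R : R) `^ (ln (p%:R : R) / ((p%:R - 1) * ln (2%:R : R)))
    = (p ^ m)%:R.
Proof.
move=> p_gt1; have p_gt0 := ltnW p_gt1.
have ln2 : ln (2%:R : R) != 0 by rewrite gt_eqF // ln_gt0 // ltr1n.
have p1 : (p%:R - 1 : R) != 0 by rewrite subr_eq0 pnatr_eq1 gtn_eqF.
rewrite /powR pnatr_eq0 expn_eq0 /= natrX lnXn ?ltr0n //.
rewrite -[ln 2 *+ _]mulr_natl natrM -subn1 natrB //.
have -> : ln p%:R / ((p%:R - 1) * ln 2) * ((p%:R - 1) * m%:R * ln 2)
    = m%:R * ln (p%:R : R) by field; rewrite p1 ln2.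
by rewrite mulr_natl -lnXn ?ltr0n // lnK ?natrX // posrE exprn_gt0 ?ltr0n.
Qed.

Lemma prime_growth_bound (R : realType) (p m : nat) :
  prime p -> (3 <= p)%N ->
  (forall n : nat, (2 ^ p <= n)%N ->
     `| (signed_sum p n)%:~R : R |
       <= (n%:R : R) `^ (ln (p%:R : R) / ((p%:R - 1) * ln (2%:R : R)))) ->
  (2 <= m)%N -> `|signed_sum p (2 ^ (p.-1 * m))| <= (p ^ m)%:Z.
Proof.
move=> p_pr p_ge3 hS m_ge2; have p_gt1 := prime_gt1 p_pr.
(* The bound [2 <= m] is what carries the argument past the threshold [2 ^ p]. *)
have p_le : (p <= p.-1 * m)%N.
  by apply: (@leq_trans (p.-1 * 2)); [lia | rewrite leq_mul2l m_ge2 orbT].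
have /hS : (2 ^ p <= 2 ^ (p.-1 * m))%N by rewrite leq_exp2l.
by rewrite powR_rate // -intr_norm -[(p ^ m)%:R]/((p ^ m)%N%:~R) ler_int.
Qed.

Lemma expr_pow2_pred (R : comNzRingType) (x : R) p :
  prime p -> (3 <= p)%N -> x ^+ p = 1 -> x ^+ (2 ^ p.-1) = x.
Proof.
move=> p_pr p_ge3 xp; rewrite -(expr_mod _ xp).
have co : coprime 2 p by rewrite coprime_sym prime_coprime // gtnNdvd.
rewrite -(totient_prime p_pr) (Euler_exp_totient co).
by rewrite modn_small ?expr1 // prime_gt1.
Qed.

(** * The products A_j at the p-th roots of unity *)

Section RootsOfUnity.

Variables (p : nat) (z : algC).
Hypotheses (p_pr : prime p) (p_ge3 : (3 <= p)%N) (prim_z : p.-primitive_root z).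

Let A j := dyadic_prod p.-1 (z ^+ j).

Let zj_p j : (z ^+ j) ^+ p = 1.
Proof. by rewrite exprAC (prim_expr_order prim_z) expr1n. Qed.

Let zj_pow2 j : (z ^+ j) ^+ (2 ^ p.-1) = z ^+ j.
Proof. exact: expr_pow2_pred. Qed.

Let coprime_index j : (0 < j < p)%N -> coprime j p.
Proof. by case/andP=> j0 jp; rewrite coprime_sym prime_coprime // gtnNdvd. Qed.

Lemma dyadic_prod_root_real j : A j \is Num.real.
Proof.
apply: dyadic_prod_real => //.
  by apply/eqP; rewrite -(pexpr_eq1 (prime_gt0 p_pr)) // -normrX zj_p normr1.
by case: (even_prime p_pr) => p_odd; lia.
Qed.

Lemma signed_sum_pow2M m : (0 < m)%N ->
  p%:R * (signed_sum p (2 ^ (p.-1 * m)))%:~R = \sum_(1 <= j < p) A j ^+ m.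
Proof.
move=> m_gt0; rewrite (signed_sum_prim_root prim_z); last by nia.
by apply: eq_bigr => j _; exact: dyadic_prod_period.
Qed.

(** For fixed [k], [z ^+ (2 ^ k)] is again primitive because [p] is odd, so the product over [j] is
    [p]; there are [p.-1] values of [k]. *)
Lemma prod_dyadic_prod_root : \prod_(1 <= j < p) A j = p%:R ^+ p.-1.
Proof.
rewrite /A /dyadic_prod exchange_big /= -[in RHS](card_ord p.-1) -prodr_const.
apply: eq_bigr => k _.
have prim_zk : p.-primitive_root (z ^+ (2 ^ k)).
  rewrite prim_root_exp_coprime // coprimeXl // coprime_sym prime_coprime //.
  by rewrite gtnNdvd.
by rewrite -(prod_sub1_prim_root prim_zk); apply: eq_bigr => j _; rewrite exprAC.
Qed.

Lemma dyadic_prod_root_norm_le j :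
  (forall m, (2 <= m)%N -> `|signed_sum p (2 ^ (p.-1 * m))| <= (p ^ m)%:Z) ->
  (0 < j < p)%N -> `|A j| <= p%:R.
Proof.
(* The constant [p%:R] is the factor in front of [signed_sum] in [signed_sum_pow2M]; one even power
   is at most the sum of all of them. *)
move=> hS j_range; apply: (@le_of_expr_le _ _ _ p%:R); rewrite ?ltr0n ?prime_gt0 //.
move=> n; rewrite -exprM -exprM.
have even_ge0 i : 0 <= A i ^+ (n.+1 * 2).
  by rewrite exprM real_exprn_even_ge0 // rpredX // dyadic_prod_root_real.
rewrite -normrX (ger0_norm (even_ge0 j)).
apply: (@le_trans _ _ (\sum_(1 <= i < p) A i ^+ (n.+1 * 2))).
  rewrite (bigD1_seq j) ?mem_index_iota ?iota_uniq //= lerDl.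
  by apply: sumr_ge0.
rewrite -signed_sum_pow2M // ler_wpM2l // -natrX.
rewrite -[(p ^ _)%:R]/((p ^ (n.+1 * 2))%N%:~R) ler_int.
by apply: le_trans (ler_norm _) (hS _ _); lia.
Qed.

(** The other p - 2 factors have norm at most [p], while the whole product is p^(p-1), which leaves
    at least [p] for [A 1]. *)
Lemma dyadic_prod_root_norm :
  (forall m, (2 <= m)%N -> `|signed_sum p (2 ^ (p.-1 * m))| <= (p ^ m)%:Z) ->
  `|A 1| = p%:R.
Proof.
move=> hS; have p_gt1 := prime_gt1 p_pr.
apply/le_anti; rewrite dyadic_prod_root_norm_le //=.
have pn_gt0 : 0 < p%:R ^+ p.-2 :> algC by rewrite exprn_gt0 ?ltr0n ?prime_gt0.
rewrite -(ler_pM2r pn_gt0) -exprS prednK; last by lia.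
rewrite -prod_dyadic_prod_root.
have -> : \prod_(1 <= j < p) A j = `|\prod_(1 <= j < p) A j|.
  by rewrite prod_dyadic_prod_root ger0_norm // exprn_ge0.
rewrite big_ltn // normrM ler_wpM2l // normr_prod.
have -> : p%:R ^+ p.-2 = \prod_(2 <= j < p) p%:R :> algC.
  by rewrite prodr_const_nat; congr (_ ^+ _); lia.
rewrite !big_nat; apply: ler_prod => j /andP[j2 jp].
by rewrite normr_ge0 dyadic_prod_root_norm_le // jp ltnW.
Qed.

(** An automorphism of [algC] sending [z] to [z ^+ j] carries [A 1] to [A j] and fixes the integer
    value of [A 1]. *)
Lemma dyadic_prod_root_const e :
  A 1 = (-1) ^+ e * p%:R -> forall j, (0 < j < p)%N -> A j = (-1) ^+ e * p%:R.
Proof.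
move=> A1 j j_range; have [u uE] := Qn_aut_exists (coprime_index j_range).
have := congr1 u A1; rewrite rmorphM rmorph_sign rmorph_nat => <-.
rewrite /A /dyadic_prod rmorph_prod; apply: eq_bigr => k _.
rewrite rmorphB rmorph1 rmorphXn /= expr1 uE //; exact: prim_expr_order.
Qed.

Lemma signed_sum_pow2_eq (e : nat) :
  A 1 = (-1) ^+ e * p%:R -> signed_sum p (2 ^ p) = (-1) ^+ e * p%:Z.
Proof.
move=> A1; have p_gt0 := prime_gt0 p_pr.
have p_neq0 : p%:R != 0 :> algC by rewrite pnatr_eq0 -lt0n.
apply: (intr_inj (R := algC)); apply: (mulfI p_neq0).
rewrite (signed_sum_prim_root prim_z) //.
rewrite (eq_big_nat _ _ (F2 := fun j => (-1) ^+ e * p%:R * (1 - z ^+ j))); last first.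
  move=> j j_range; rewrite -(dyadic_prod_root_const A1 j_range).
  (* Passing from p - 1 to p factors adds 1 - z^(j 2^(p-1)), which is 1 - z^j. *)
  by rewrite -{1}(prednK p_gt0) dyadic_prodS zj_pow2.
rewrite -mulr_sumr (_ : \sum_(1 <= j < p) (1 - z ^+ j) = p%:R).
  by rewrite rmorphM rmorph_sign /=; ring.
(* The zero term [j = 0] is restored so that the full sum of roots of unity, which vanishes,
   appears. *)
transitivity (\sum_(0 <= j < p) (1 - z ^+ j)).
  by rewrite [RHS]big_ltn // subrr add0r.
rewrite sumrB big_mkord sumr_const card_ord big_mkord.
have := sum_expr_prim_root 1 prim_z; rewrite dvdn1 gtn_eqF ?prime_gt1 //.
by under eq_bigr do rewrite expr1; move->; rewrite subr0.
Qed.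

End RootsOfUnity.

Theorem theorem2 (R : realType) (p : nat) (hp : prime p) (hp3 : (3 <= p)%N)
  (hS : forall n : nat, (2 ^ p <= n)%N ->
     `| (signed_sum p n)%:~R : R |
       <= (n%:R : R) `^ (ln (p%:R : R) / ((p%:R - 1) * ln (2%:R : R))))
  (hdvd : (p%:Z %| signed_sum p (2 ^ p)%N)%Z) :
  signed_sum p (2 ^ p)%N = p%:Z \/ signed_sum p (2 ^ p)%N = - p%:Z.
Proof.
have [z prim_z] := C_prim_root_exists (prime_gt0 hp).
have bound m := @prime_growth_bound _ _ m hp hp3 hS.
have normA := dyadic_prod_root_norm hp hp3 prim_z bound.
(* The exponent [e] is the boolean [A 1 < 0] read as 0 or 1. *)
have := realEsign (dyadic_prod_root_real hp hp3 prim_z 1); rewrite normA.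
move/(signed_sum_pow2_eq hp hp3 prim_z) => ->.
by case: (_ < 0); rewrite ?expr1 ?expr0 ?mulN1r ?mul1r; [right | left].
Qed.
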